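(* Let $p=3$ and let $\ell_p$ be the real $\ell_p$-space. Let $\mathcal{B}_1(\ell_p)$ be the set of all bounded linear operators $T$ on $\ell_p$ with $\|T\|\le 1$, and for $T\in\mathcal{B}_1(\ell_p)$ let $\mathcal{N}(T):=\{z\in\ell_p\setminus\{0\}:\ \|Tz\|=\|T\|\,\|z\|\}$. Then the set of all $T\in\mathcal{B}_1(\ell_p)$ such that the closed linear span of $\mathcal{N}(T)$ is equal to $\ell_p$ is dense in $\mathcal{B}_1(\ell_p)$ for the topology $\mathtt{SOT}$.
   Context: $\mathtt{SOT}$ is the topology of pointwise norm convergence: $T_i\to T$ iff $\|T_ix-Tx\|\to 0$ for every $x$. *)

(* Defs.v *)
From HB Require Import structures.
From mathcomp Require Import all_boot all_order all_algebra.
From mathcomp Require Import finmap.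
From mathcomp Require Import all_classical all_reals all_analysis.

Set Implicit Arguments.
Unset Strict Implicit.
Unset Printing Implicit Defensive.

Import Order.TTheory GRing.Theory Num.Theory.
Import numFieldTopology.Exports numFieldNormedType.Exports.

Local Open Scope classical_set_scope.
Local Open Scope ring_scope.

(* Real sequences with finite p-norm, as the functions in L^p of the counting
   measure on nat. No quotient by a.e. equality is needed since only the empty
   set is negligible. *)
Definition ell (R : realType) (p : \bar R) (p1 : (1 <= p)%E) : Type :=
  LfunType (@counting nat R) p1.

Section ell_normed.
Context (R : realType) (p : \bar R) (p1 : (1 <= p)%E).

HB.instance Definition _ := GRing.Lmodule.copy (ell p1)
  (LfunType (@counting nat R) p1).

Definition ell_coord (x : ell p1) : nat -> R :=
  (x : LfunType (@counting nat R) p1).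

Definition ell_norm (x : ell p1) : R :=
  fine ('N[@counting nat R]_p [EFin \o ell_coord x])%E.

Lemma ell_normD (x y : ell p1) : ell_norm (x + y) <= ell_norm x + ell_norm y.
Proof. exact: ler_LnormD. Qed.

Lemma ell_normZ (a : R) (x : ell p1) : ell_norm (a *: x) = `|a| * ell_norm x.
Proof.
apply/EFin_inj; rewrite EFinM /ell_norm !finite_norm_fine.
exact: LnormZ.
Qed.

Lemma ell_norm_eq0 (x : ell p1) : ell_norm x = 0 -> x = 0.
Proof.
move=> /fine_Lnormr_eq0[N [_ N0 xN]].
apply/LfuneqP => k; apply: contrapT => xk0.
have Nk : N k by apply: xN => /= h; exact: xk0 (h I).
have : @counting nat R N = 0%E := N0.
rewrite /counting; case: asboolP => // finN.
move=> -[] /eqP; rewrite pnatr_eq0 cardfs_eq0 => /eqP fN0.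
suff : k \in fset_set N by rewrite fN0.
by rewrite in_fset_set// inE.
Qed.

HB.instance Definition _ :=
  @Lmodule_isNormed.Build R (ell p1) ell_norm ell_normD ell_normZ ell_norm_eq0.

End ell_normed.

Coercion ell_coord : ell >-> Funclass.

Lemma ell_normE (R : realType) (r : R) (r1 : (1 <= r%:E)%E) (x : ell r1) :
  `|x|%:E = ((\sum_(k <oo) (`|x k| `^ r)%:E) `^ r^-1)%E.
Proof.
have r0 : 0 < r by rewrite (lt_le_trans ltr01).
rewrite [LHS](_ : _ = (ell_norm x)%:E)// /ell_norm finite_norm_fine.
by rewrite Lnorm_counting.
Qed.

Lemma lee13 (R : realType) : (1 <= (3 : R)%:E)%E.
Proof. by rewrite (lee1n 3). Qed.

Section bounded_operators.
Context (R : realType) (V W : normedModType R).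

Record boundedOp := BoundedOp {
  boundedOp_fun :> {linear V -> W} ;
  boundedOp_bounded : bounded_near boundedOp_fun (nbhs (0 : V)) }.

HB.instance Definition _ := gen_eqMixin boundedOp.
HB.instance Definition _ := gen_choiceMixin boundedOp.

Definition opnorm (T : boundedOp) : R :=
  sup [set `|T x| | x in [set x : V | `|x| <= 1]].

Lemma opnorm_has_sup (T : boundedOp) :
  has_sup [set `|T x| | x in [set x : V | `|x| <= 1]].
Proof.
split; first by exists `|T 0|, 0 => //=; rewrite normr0.
have /bounded_funP/(_ 1)[M TM] := boundedOp_bounded T.
by exists M => _ [x x1 <-]; exact: TM.
Qed.

Lemma opnorm_ge0 (T : boundedOp) : 0 <= opnorm T.
Proof.
apply: (@le_trans _ _ `|T 0|) => //.
apply: ub_le_sup; first exact: (opnorm_has_sup T).2.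
by exists 0 => //=; rewrite normr0.
Qed.

Lemma le_opnormM (T : boundedOp) (x : V) : `|T x| <= opnorm T * `|x|.
Proof.
have [->|x0] := eqVneq x 0; first by rewrite linear0 !normr0 mulr0.
have nx : 0 < `|x| by rewrite normr_gt0.
rewrite -ler_pdivrMr// mulrC.
have -> : `|x|^-1 * `|T x| = `|T (`|x|^-1 *: x)|.
  by rewrite linearZ/= normrZ ger0_norm// invr_ge0 ltW.
apply: ub_le_sup; first exact: (opnorm_has_sup T).2.
exists (`|x|^-1 *: x) => //=.
rewrite normrZ ger0_norm ?invr_ge0 ?(ltW nx)//.
by rewrite mulVf// gt_eqF.
Qed.

Lemma opnorm_le (T : boundedOp) (M : R) : 0 <= M ->
  (forall x, `|T x| <= M * `|x|) -> opnorm T <= M.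
Proof.
move=> M0 TM; apply: ge_sup; first exact: (opnorm_has_sup T).1.
move=> _ [x /= x1 <-]; apply: (le_trans (TM x)).
by rewrite -[leRHS]mulr1 ler_wpM2l.
Qed.

(* The canonical topology on bounded operators is the strong operator topology
   and not the norm topology. *)
HB.instance Definition _ := Topological.copy boundedOp
  (@initial_topology boundedOp {ptws V -> W} (fun T => T : V -> W)).

Lemma SOT_cvgP (F : set_system boundedOp) (T : boundedOp) : Filter F ->
  F --> T <-> forall x, `|S x - T x| @[S --> F] --> (0 : R).
Proof.
move=> FF; pose i (S : boundedOp) : {ptws V -> W} := S : V -> W.
have ic : continuous i := @initial_continuous boundedOp {ptws V -> W} i.
have FiF : F --> T <-> i @ F --> i T.
  split=> [FT|FT A]; first exact: cvg_trans (cvg_app i FT) (ic T).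
  move=> [_ [[B oB <-] BT BA]]; apply: filterS BA _.
  by apply: FT; apply: open_nbhs_nbhs.
apply: (iff_trans FiF); apply: (iff_trans (pointwise_cvgP _ _)).
split=> FT x.
  have : (fun S : boundedOp => S x) @ F --> T x by exact: FT.
  move=> /cvgr_dist_lt FTx; apply/cvgr0Pnorm_lt => e e0.
  by have := FTx e e0; apply: filterS => S /=; rewrite normr_id distrC.
apply/cvgrPdist_lt => e e0.
by have /cvgr0_norm_lt/(_ e e0) := FT x;
  apply: filterS => S /=; rewrite normr_id distrC.
Qed.

Definition op_ball1 : set boundedOp := [set T | opnorm T <= 1].

Definition norm_attaining (T : boundedOp) : set V :=
  [set z | z != 0 /\ `|T z| = opnorm T * `|z|].

End bounded_operators.
Arguments op_ball1 {R} V W _.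

Definition linear_span (R : realType) (V : lmodType R) (A : set V) : set V :=
  [set v | exists n (c : 'I_n -> R) (z : 'I_n -> V),
     (forall i, A (z i)) /\ v = \sum_(i < n) c i *: z i].

Definition closed_span (R : realType) (V : normedModType R) (A : set V) :
  set V := closure (linear_span A).

(* Main.v *)
From HB Require Import structures.
Require Import Defs.
From mathcomp Require Import all_boot all_order all_algebra.
From mathcomp Require Import all_classical all_reals all_analysis.
From mathcomp Require Import ring lra.
Import Order.TTheory GRing.Theory Num.Theory.
Import numFieldTopology.Exports numFieldNormedType.Exports.

(** Given a contraction [T] of [l_3] and [n], let [P] be the projection on the
    first [n] coordinates and [A = c P T P] with [c < 1] close to 1. Since [A]
    converges strongly to [T] as [n] grows and [c] tends to 1, it suffices to
    find a contraction [S] whose norming vectors span a dense subspace and which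
    is close to [A] on the range of [P].

    The operator [S] is sought in the form [(x, y, w) |-> (A x, B (x, y), w)],
    with [x] the first [n] coordinates, [y] one more coordinate and [w] the tail
    of the sequence, the three values being put in disjoint blocks of
    coordinates. The tail is mapped isometrically, so [S] attains its norm 1 at
    each of its unit vectors, and what remains is a problem about the matrices
    [B] in the compact convex set
    [||A x||^3 + ||B (x, y)||^3 <= ||x||^3 + |y|^3]. Choose [B] there so as to
    maximize a linear form.

    - If, for each nonzero [phi], the linear form pairs nontrivially with some
      rank one matrix [phi u], the norming vectors [z = (x, y)] of a maximizer
      span everything: were they contained in the kernel of some [phi], a small step
      from [B] towards such a matrix would keep the constraint, by convexity
      and compactness, and increase the form ([norming_not_in_hyperplane]).

    - If the linear form is a small perturbation of the sum of the entries of
      [B (0, 1)], that vector is close to the multiple of [(1, ..., 1)] of norm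
      1, hence has full support. In [l_3], an operator which is nearly
      isometric on [y] and sends it to a vector [a] of full support must nearly
      kill [x]: averaging [||a + t b||^3] and [||a - t b||^3] produces a term
      of order [t^2], while the norm of [(x, y)] leaves room only for [t^3].
      So [B] is small on [x] ([maximizer_small]).

    Both conditions are compatible, which gives [spanning_dilation] and then
    [SOT_approx]. *)

Local Open Scope classical_set_scope.
Local Open Scope ring_scope.

Set Implicit Arguments.
Unset Strict Implicit.
Unset Printing Implicit Defensive.

(** * Continuity of sums of cubes *)

Lemma continuous_sum (R : realType) (T : topologicalType) (I : finType)
    (P : pred I) (f : I -> T -> R) :
  (forall i, continuous (f i)) -> continuous (fun x => \sum_(i | P i) f i x).
Proof.
move=> cf x; apply: (@cvg_big R _ _ _ _ _ _ _ _ _ (fun i => f i x)).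
  exact: add_continuous.
by move=> i _; exact: cf.
Qed.

Lemma continuous_cube (R : realType) (T : topologicalType) (f : T -> R) :
  continuous f -> continuous (fun x => `|f x| ^+ 3).
Proof.
move=> cf x; have nf : `|f y| @[y --> x] --> `|f x| by apply: cvg_norm; exact: cf.
have -> : (fun y => `|f y| ^+ 3)
    = (fun y => `|f y|) \* ((fun y => `|f y|) \* (fun y => `|f y|)).
  by apply/funext => y /=; rewrite !exprS expr0 mulr1.
by do 2!apply: cvgM => //.
Qed.

Lemma continuous_scale (R : realType) (T : topologicalType) (c : R)
    (f : T -> R) :
  continuous f -> continuous (fun x => c * f x).
Proof.
by move=> cf x; apply: continuousM; [exact: cst_continuous|exact: cf].
Qed.

Lemma continuous_add (R : realType) (T : topologicalType) (f g : T -> R) :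
  continuous f -> continuous g -> continuous (fun x => f x + g x).
Proof. by move=> cf cg x; apply: continuousD; [exact: cf|exact: cg]. Qed.

Lemma continuous_sub (R : realType) (T : topologicalType) (f g : T -> R) :
  continuous f -> continuous g -> continuous (fun x => f x - g x).
Proof. by move=> cf cg x; apply: continuousB; [exact: cf|exact: cg]. Qed.

Lemma continuous_mulmx_row (R : realType) (m p : nat) (B : 'M[R]_(m, p)) j :
  continuous (fun z : 'rV[R]_m => (z *m B) 0 j).
Proof.
have -> : (fun z : 'rV[R]_m => (z *m B) 0 j)
    = fun z : 'rV[R]_m => \sum_k B k j * z 0 k.
  by apply/funext => w; rewrite mxE; apply: eq_bigr => k _; rewrite mulrC.
by apply: continuous_sum => k; apply: continuous_scale; exact: coord_continuous.
Qed.

(** The cube of the norm of [l_3^m]: cubes keep everything polynomial. *)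
Definition cubes (R : realType) (m : nat) (z : 'rV[R]_m) : R :=
  \sum_i `|z 0 i| ^+ 3.

Lemma continuous_cubes (R : realType) (m : nat) (T : topologicalType)
    (f : T -> 'rV[R]_m) :
  (forall i, continuous (fun x => f x 0 i)) -> continuous (fun x => cubes (f x)).
Proof. by move=> cf; apply: continuous_sum => i; exact: continuous_cube. Qed.

Lemma cubes_ge0 (R : realType) (m : nat) (z : 'rV[R]_m) : 0 <= cubes z.
Proof. by apply: sumr_ge0 => i _; rewrite exprn_ge0. Qed.

Lemma cubes0 (R : realType) (m : nat) : cubes (0 : 'rV[R]_m) = 0.
Proof. by rewrite /cubes big1// => i _; rewrite mxE normr0 expr0n. Qed.

Lemma cubesZ (R : realType) (m : nat) (c : R) (z : 'rV[R]_m) :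
  cubes (c *: z) = `|c| ^+ 3 * cubes z.
Proof. by rewrite /cubes mulr_sumr; apply: eq_bigr => i _; rewrite mxE normrM exprMn. Qed.

Lemma cubes_gt0 (R : realType) (m : nat) (z : 'rV[R]_m) : z != 0 -> 0 < cubes z.
Proof.
move=> z0; rewrite lt_neqAle cubes_ge0 andbT eq_sym; apply: contra_neq z0.
move=> /eqP; rewrite psumr_eq0; last by move=> i _; rewrite exprn_ge0.
move=> /allP z0; apply/rowP => i; rewrite mxE.
by have := z0 i (mem_index_enum _); rewrite expf_eq0/= normr_eq0 => /eqP.
Qed.

Lemma le_coord_cubes (R : realType) (m : nat) (z : 'rV[R]_m) i :
  `|z 0 i| ^+ 3 <= cubes z.
Proof.
by rewrite /cubes (bigD1 i)//= lerDl sumr_ge0// => j _; rewrite exprn_ge0.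
Qed.

(** For nonnegative [x] and [y] the convexity defect of the cube factors as
    [t (1 - t) (x - y)^2 ((2 - t) x + (1 + t) y)]. *)
Lemma cube_convex (R : realType) (t a b : R) : 0 <= t <= 1 ->
  `|(1 - t) * a + t * b| ^+ 3 <= (1 - t) * `|a| ^+ 3 + t * `|b| ^+ 3.
Proof.
move=> /andP[t0 t1].
have h : `|(1 - t) * a + t * b| <= (1 - t) * `|a| + t * `|b|.
  rewrite (le_trans (ler_normD _ _))// !normrM (ger0_norm t0) ger0_norm//.
  by rewrite subr_ge0.
apply: (@le_trans _ _ (((1 - t) * `|a| + t * `|b|) ^+ 3)).
  by rewrite lerXn2r// nnegrE ?addr_ge0 ?mulr_ge0 ?subr_ge0.
have := normr_ge0 a; have := normr_ge0 b.
set x := `|a|; set y := `|b| => y0 x0.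
have -> : ((1 - t) * x + t * y) ^+ 3 = (1 - t) * x ^+ 3 + t * y ^+ 3
  - t * (1 - t) * (x - y) ^+ 2 * ((2 - t) * x + (1 + t) * y) by ring.
rewrite gerBl; apply: mulr_ge0; last by apply: addr_ge0; apply: mulr_ge0 => //; lra.
by rewrite mulr_ge0 ?sqr_ge0// mulr_ge0// subr_ge0.
Qed.

Lemma cubes_convex (R : realType) (m : nat) (t : R) (v w : 'rV[R]_m) :
  0 <= t <= 1 ->
  cubes ((1 - t) *: v + t *: w) <= (1 - t) * cubes v + t * cubes w.
Proof.
move=> t01; rewrite /cubes !mulr_sumr -big_split/=.
by apply: ler_sum => i _; rewrite !mxE; exact: cube_convex.
Qed.

(** * Contractive dilations and a linear objective *)

(** Such an [alpha] stands for [z |-> ||A x||^3], where [x] consists of all the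
    coordinates of [z] but the last and [||A||^3 <= theta]. *)
Definition cubic_gauge (R : realType) (n : nat) (theta : R)
    (alpha : 'rV[R]_n.+1 -> R) :=
  [/\ continuous alpha, forall c z, alpha (c *: z) = `|c| ^+ 3 * alpha z,
      forall z, 0 <= alpha z &
      forall z, alpha z <= theta * (cubes z - `|z 0 ord_max| ^+ 3)].

Lemma cubic_gauge_le (R : realType) (n : nat) (theta : R)
    (alpha : 'rV[R]_n.+1 -> R) z :
  0 <= theta -> cubic_gauge theta alpha -> alpha z <= theta * cubes z.
Proof.
move=> t0 [_ _ _ /(_ z)] /le_trans; apply.
by rewrite ler_wpM2l// gerBl exprn_ge0.
Qed.

(** The matrices [B] (acting on rows) for which [z |-> (A x, z B)] is a
    contraction of [l_3^n.+1] into [l_3^n (+) l_3^n.+1]. *)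
Definition admissible (R : realType) (n : nat) (alpha : 'rV[R]_n.+1 -> R)
    (B : 'M[R]_n.+1) :=
  forall z, alpha z + cubes (z *m B) <= cubes z.

(** A linear form on matrices which pairs nontrivially with a rank one matrix
    [phi u] for each [phi != 0]. For small [eps] it mostly asks that the last
    basis vector be sent to a large multiple of [(1, ..., 1)]. *)
Definition objective (R : realType) (n : nat) (eps : R) (B : 'M[R]_n.+1) : R :=
  \sum_j B ord_max j + eps * \sum_(i | i != ord_max) B i i.

Lemma cubes_delta (R : realType) (m : nat) (i : 'I_m) :
  cubes ('e_i : 'rV[R]_m) = 1.
Proof.
rewrite /cubes (bigD1 i)//= big1 => [|j ji].
  by rewrite mxE !eqxx normr1 expr1n addr0.
by rewrite mxE (negbTE ji) normr0 expr0n.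
Qed.

Lemma admissible_le1 (R : realType) (n : nat) (alpha : 'rV[R]_n.+1 -> R)
    (B : 'M[R]_n.+1) i j :
  (forall z, 0 <= alpha z) -> admissible alpha B -> `|B i j| <= 1.
Proof.
move=> a0 aB; rewrite -(@expr_le1 _ 3)//.
have := aB 'e_i; rewrite cubes_delta -rowE => h.
have := le_coord_cubes (row i B) j; rewrite mxE => /le_trans; apply.
by apply: le_trans h; rewrite lerDr.
Qed.

(** The admissible matrices form a compact set: their entries are bounded by
    1 and each constraint is closed. *)
Lemma objective_max (R : realType) (n : nat) (alpha : 'rV[R]_n.+1 -> R)
    (eps : R) :
  (forall z, 0 <= alpha z) -> (forall z, alpha z <= cubes z) ->
  exists2 B, admissible alpha B &
    forall C, admissible alpha C -> objective eps C <= objective eps B.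
Proof.
move=> a0 a1; pose N := (n.+1 * n.+1)%N.
pose M (v : 'rV[R]_N) : 'M[R]_n.+1 := vec_mx v.
have cM i j : continuous (fun v => M v i j).
  rewrite (_ : (fun v => _) = (fun v : 'rV[R]_N => v 0 (mxvec_index i j))).
    exact: coord_continuous.
  by apply/funext => v; rewrite mxE.
pose A := [set v : 'rV[R]_N | admissible alpha (M v)].
have A0 : A !=set0.
  by exists (mxvec 0) => z; rewrite /M mxvecK mulmx0 cubes0 addr0.
have bA : bounded_set A.
  exists 1; split=> // r r1 v Av /=; apply: le_trans (ltW r1).
  rewrite [leLHS]/Num.Def.normr/=.
  rewrite mx_normrE; apply/bigmax_leP; split=> // -[k l] _ /=.
  rewrite ord1; case/mxvec_indexP: l => i j.
  by have := admissible_le1 i j a0 Av; rewrite mxE.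
have cA : closed A.
  rewrite (_ : A = \bigcap_(z in [set: 'rV[R]_n.+1])
    (fun v => cubes (z *m M v)) @^-1` [set x | x <= cubes z - alpha z]).
    apply: closed_bigI => z _; apply: preimage_closed; last exact: closed_le.
    move=> v _; apply: continuous_cubes => j.
    rewrite (_ : (fun _ => _) = fun v => \sum_k z 0 k * M v k j); last first.
      by apply/funext => w; rewrite mxE.
    by apply: continuous_sum => k; apply: continuous_scale; exact: cM.
  apply/seteqP; split => v /= Av; first by move=> z _ /=; rewrite lerBrDl; exact: Av.
  by move=> z; have := Av z I; rewrite /= lerBrDl.
have cobj : continuous (fun v => objective eps (M v)).
  apply: continuous_add; first by apply: continuous_sum => j; exact: cM.
  by apply: continuous_scale; apply: continuous_sum => j; exact: cM.
have [v] := EVT_max_rV A0 (bounded_closed_compact bA cA) (continuous_subspaceT cobj).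
rewrite inE => Av maxv; exists (M v) => // C aC.
have := maxv (mxvec C); rewrite inE/= /A/= /M mxvecK; exact.
Qed.

Lemma objective_affine (R : realType) (n : nat) (eps t : R)
    (B D : 'M[R]_n.+1) :
  objective eps ((1 - t) *: B + t *: D)
    = (1 - t) * objective eps B + t * objective eps D.
Proof.
rewrite /objective.
under eq_bigr do rewrite !mxE.
under [X in _ + eps * X = _]eq_bigr do rewrite !mxE.
rewrite !big_split/= -!mulr_sumr; ring.
Qed.

(** For a row [u], the objective of [phi u] is
    [phi_last * sum u + eps * sum_(i != last) phi_i u_i]: take [u] along the
    last basis vector if [phi_last != 0] and [u = phi^T] otherwise. *)
Lemma objective_rank1 (R : realType) (n : nat) (eps : R) (phi : 'cV[R]_n.+1) :
  0 < eps -> phi != 0 ->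
  forall M, exists u : 'rV[R]_n.+1, M < objective eps (phi *m u).
Proof.
move=> e0 phi0 M.
have obj v : objective eps (phi *m v) = phi ord_max 0 * (\sum_j v 0 j)
    + eps * \sum_(i | i != ord_max) phi i 0 * v 0 i.
  rewrite /objective mulr_sumr; congr (_ + _ * _).
    by apply: eq_bigr => j _; rewrite mxE big_ord1.
  by apply: eq_bigr => j _; rewrite mxE big_ord1.
suff [u u0] : exists u, 0 < objective eps (phi *m u).
  exists (((`|M| + 1) / objective eps (phi *m u)) *: u).
  have -> : forall c : R, objective eps (phi *m (c *: u)) = c * objective eps (phi *m u).
    move=> c; rewrite -scalemxAr; have := objective_affine eps c 0 (phi *m u).
    rewrite scaler0 add0r => ->; rewrite (_ : objective eps 0 = 0) ?mulr0 ?add0r//.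
    by rewrite /objective !big1 ?mulr0 ?addr0// => i _; rewrite mxE.
  by rewrite divfK ?gt_eqF// (le_lt_trans (ler_norm M))// ltrDl.
have [pm0|pm0] := eqVneq (phi ord_max 0) 0.
  exists phi^T; rewrite obj pm0 mul0r add0r mulr_gt0// lt_neqAle.
  under eq_bigr do rewrite mxE -expr2.
  rewrite sumr_ge0 ?andbT//; last by move=> i _; rewrite sqr_ge0.
  rewrite eq_sym psumr_eq0; last by move=> i _; rewrite sqr_ge0.
  apply: contra_neqN phi0 => /allP h; apply/colP => i; rewrite mxE.
  have [->//|im] := eqVneq i ord_max.
  by have := h i (mem_index_enum _); rewrite im/= sqrf_eq0 => /eqP.
exists (phi ord_max 0 *: 'e_ord_max); rewrite obj.
rewrite (bigD1 ord_max)//= big1 => [|j jm]; last by rewrite !mxE (negbTE jm) mulr0.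
rewrite big1 => [|j jm]; last by rewrite !mxE (negbTE jm) !mulr0.
by rewrite !mxE !eqxx mulr1 !addr0 mulr0 addr0 -expr2 lt_neqAle sqr_ge0 eq_sym sqrf_eq0 pm0.
Qed.

(** * Norming vectors of a maximizer *)

(** If [phi] vanished on all the norming vectors of the maximizer [B], one
    could move [B] slightly towards a rank one matrix [D = phi u] with a larger
    objective. By convexity of the cube, [(1 - t) B + t D] is admissible at [z]
    as soon as [t exc z <= (1 - t) gap z], where [gap] is the slack of the
    constraint of [B] and [exc] the violation of the constraint of [D]. On the
    unit sphere, [gap] can vanish only where [phi] does; there [D] sends [z] to 0
    and its constraint is strict because [theta < 1]. Hence [gap] is bounded
    below on the compact set where [exc >= 0], and a small [t] works. This
    contradicts maximality. *)
Lemma norming_not_in_hyperplane (R : realType) (n : nat) (theta eps : R)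
    (alpha : 'rV[R]_n.+1 -> R) (B : 'M[R]_n.+1) (phi : 'cV[R]_n.+1) :
  0 < eps -> 0 <= theta < 1 -> cubic_gauge theta alpha -> admissible alpha B ->
  (forall C, admissible alpha C -> objective eps C <= objective eps B) ->
  phi != 0 ->
  exists z, alpha z + cubes (z *m B) = cubes z /\ z *m phi != 0.
Proof.
move=> e0 /andP[t0 t1] cub aB maxB phi0.
have [ca ha a0 _] := cub.
apply: contrapT => noz.
have {}noz z : alpha z + cubes (z *m B) = cubes z -> z *m phi = 0.
  by move=> zB; apply: contrapT => /eqP zphi; apply: noz; exists z.
have [u uB] := objective_rank1 e0 phi0 (objective eps B).
pose D := phi *m u.
pose gap z := cubes z - (alpha z + cubes (z *m B)).
pose exc z := alpha z + cubes (z *m D) - cubes z.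
have cc p (C : 'M[R]_(n.+1, p)) : continuous (fun z : 'rV[R]_n.+1 => cubes (z *m C)).
  by apply: continuous_cubes => j; exact: continuous_mulmx_row.
have cid : continuous (fun z : 'rV[R]_n.+1 => cubes z).
  by apply: continuous_cubes => j; exact: coord_continuous.
have cgap : continuous gap.
  apply: continuous_sub => //.
  by apply: continuous_add => //; exact: cc.
have cexc : continuous exc.
  apply: continuous_sub => //.
  by apply: continuous_add => //; exact: cc.
pose K := [set z : 'rV[R]_n.+1 | `|z| = 1 /\ 0 <= exc z].
have bK : bounded_set K.
  exists 1; split=> // r r1 v [Kv _] /=; by rewrite Kv ltW.
have cK : closed K.
  rewrite (_ : K = (fun z => `|z|) @^-1` [set 1] `&` exc @^-1` [set x | 0 <= x]).
    apply: closedI; apply: preimage_closed.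
    - by move=> z _; exact: norm_continuous.
    - exact: closed_eq.
    - by move=> z _; exact: cexc.
    - exact: closed_ge.
  by apply/seteqP; split.
have gap0 z : 0 <= gap z by rewrite subr_ge0; exact: aB.
have gapK z : K z -> 0 < gap z.
  move=> [z1 ez]; rewrite lt_neqAle gap0 andbT eq_sym; apply/eqP => gz.
  have zphi : z *m phi = 0 by apply: noz; apply/esym/eqP; rewrite -subr_eq0; apply/eqP.
  move: ez; rewrite /exc /D mulmxA zphi mul0mx cubes0 addr0.
  rewrite subr_ge0 leNgt => /negP; apply.
  rewrite (le_lt_trans (cubic_gauge_le z t0 cub))// gtr_pMl//.
  by apply: cubes_gt0; rewrite -normr_gt0 z1.
have [t /andP[tgt0 tle1] tK] : exists2 t : R, 0 < t <= 1 &
    forall z, K z -> t * exc z <= (1 - t) * gap z.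
  have [K0|] := pselect (K !=set0); last first.
    by move=> K0; exists 1; [rewrite ltr01 lexx|move=> z Kz; case: K0; exists z].
  have [z1] := EVT_min_rV K0 (bounded_closed_compact bK cK) (continuous_subspaceT cgap).
  rewrite inE => Kz1 minz1.
  have [z2] := EVT_max_rV K0 (bounded_closed_compact bK cK) (continuous_subspaceT cexc).
  rewrite inE => Kz2 maxz2.
  have d0 := gapK _ Kz1; have M0 := Kz2.2.
  have s0 : 0 < gap z1 + exc z2 by rewrite ltr_pwDl.
  exists (gap z1 / (gap z1 + exc z2)).
    by rewrite divr_gt0//= ler_pdivrMr// mul1r lerDl.
  move=> z Kz.
  have Ez : exc z <= exc z2 by apply: maxz2; rewrite inE.
  have Gz : gap z1 <= gap z by apply: minz1; rewrite inE.
  have -> : 1 - gap z1 / (gap z1 + exc z2) = exc z2 / (gap z1 + exc z2).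
    by field; rewrite gt_eqF.
  rewrite mulrAC [leRHS]mulrAC ler_pM2r ?invr_gt0// [gap z1 * _]mulrC.
  by apply: ler_pM => //; exact: Kz.2.
have /maxB : admissible alpha ((1 - t) *: B + t *: D).
  have t01 : 0 <= t <= 1 by rewrite ltW.
  move=> z; have [->|z0] := eqVneq z 0.
    rewrite mul0mx -(scale0r (0 : 'rV[R]_n.+1)) ha !cubesZ normr0 expr0n/= !mul0r addr0//.
  have [w w1 ->] : exists2 w, `|w| = 1 & z = `|z| *: w.
    exists (`|z|^-1 *: z); last by rewrite scalerA divff ?scale1r// normr_eq0.
    by rewrite normrZ ger0_norm ?invr_ge0// mulVf// normr_eq0.
  rewrite ha -scalemxAl !cubesZ -mulrDr ler_wpM2l ?exprn_ge0//.
  rewrite mulmxDr -!scalemxAr.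
  apply: (le_trans (lerD (lexx _) (cubes_convex _ _ t01))).
  rewrite -subr_ge0.
  have -> : cubes w - (alpha w + ((1 - t) * cubes (w *m B) + t * cubes (w *m D)))
    = (1 - t) * gap w - t * exc w by rewrite /gap /exc; ring.
  rewrite subr_ge0; have [ew|ew] := leP 0 (exc w); first exact: tK.
  apply: (@le_trans _ _ 0); first by rewrite pmulr_rle0// ltW.
  by rewrite mulr_ge0// subr_ge0.
rewrite objective_affine leNgt => /negP; apply.
rewrite -subr_gt0.
have -> : (1 - t) * objective eps B + t * objective eps D - objective eps B
  = t * (objective eps D - objective eps B) by ring.
by rewrite mulr_gt0// subr_gt0.
Qed.

(** * Smallness of a maximizer outside the last row *)

(** The cube lies above its tangent at [c >= 0]: for [a >= 0] the difference is
    [(a - c)^2 (a + 2 c)], and for [a <= 0] every term is nonnegative. *)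
Lemma cube_tangent_ge0 (R : realType) (c a : R) : 0 <= c ->
  0 <= `|a| ^+ 3 - 3 * c ^+ 2 * a + 2 * c ^+ 3.
Proof.
move=> c0; have [a0|a0] := leP 0 a.
  rewrite ger0_norm//.
  have -> : a ^+ 3 - 3 * c ^+ 2 * a + 2 * c ^+ 3 = (a - c) ^+ 2 * (a + 2 * c) by ring.
  by rewrite mulr_ge0 ?sqr_ge0//; lra.
have h1 : 0 <= c ^+ 2 * - a by rewrite mulr_ge0 ?sqr_ge0// oppr_ge0 ltW.
have h2 : 0 <= c ^+ 3 by rewrite exprn_ge0.
have h3 : 0 <= `|a| ^+ 3 by rewrite exprn_ge0.
lra.
Qed.

Lemma cube_tangent_close (R : realType) (c t a : R) : 0 < c -> 0 <= t <= c / 2 ->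
  `|a| ^+ 3 - 3 * c ^+ 2 * a + 2 * c ^+ 3 <= t ^+ 3 -> c / 2 <= a.
Proof.
move=> c0 /andP[t0 tc] h; rewrite leNgt; apply/negP => ac.
have tc3 : t ^+ 3 <= c ^+ 3 / 8.
  have -> : c ^+ 3 / 8 = (c / 2) ^+ 3 by field.
  by rewrite lerXn2r// nnegrE; lra.
have c3 : 0 < c ^+ 3 by rewrite exprn_gt0.
have [a0|a0] := leP 0 a; last first.
  have h1 : 0 <= c ^+ 2 * - a by rewrite mulr_ge0 ?sqr_ge0// oppr_ge0 ltW.
  have h3 : 0 <= `|a| ^+ 3 by rewrite exprn_ge0.
  lra.
move: h; rewrite ger0_norm//.
have -> : a ^+ 3 - 3 * c ^+ 2 * a + 2 * c ^+ 3 = (a - c) ^+ 2 * (a + 2 * c) by ring.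
apply/negP; rewrite -ltNge; apply: (@lt_le_trans _ _ ((c / 2) ^+ 2 * (2 * c))).
  have -> : (c / 2) ^+ 2 * (2 * c) = c ^+ 3 / 2 by field.
  lra.
apply: ler_pM; [exact: sqr_ge0|lra| |lra].
rewrite -[leRHS]sqrrN ler_sqr ?nnegrE; lra.
Qed.

(** This is where the exponent matters: two vectors with overlapping supports
    add up with a second order term, which cannot be absorbed by the cubic
    increase of the norm in the domain. *)
Lemma cube_second_order (R : realType) (a u : R) : 0 <= a ->
  2 * a ^+ 3 + 6 * a * u ^+ 2 <= `|a + u| ^+ 3 + `|a - u| ^+ 3.
Proof.
move=> a0.
have -> : 2 * a ^+ 3 + 6 * a * u ^+ 2 = (a + u) ^+ 3 + (a - u) ^+ 3 by ring.
by apply: lerD; rewrite -normrX ler_norm.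
Qed.

Lemma cube_root (R : realType) (x : R) : 0 < x -> exists2 c : R, 0 < c & c ^+ 3 = x.
Proof.
move=> x0; exists (x `^ 3^-1); first exact: powR_gt0.
by rewrite -powR_mulrn ?powR_ge0// -powRrM mulVf ?powRr1 ?ltW// pnatr_eq0.
Qed.

(** Comparing with the rank one matrix whose last row is [(c, ..., c)],
    [c^3 = 1 / n.+1], shows that the last row [a] of a maximizer nearly maximizes
    [sum a] over the unit ball, so that all its entries are at least [c / 2].
    Testing admissibility on [e_last + t e_i] and [e_last - t e_i] then gives
    [sum |a|^3 + 3 t^2 sum a b^2 <= 1 + t^3] for each other row [b]; since
    [sum |a|^3] is almost 1, this forces [sum b^2 = O(t / c)]. *)
Lemma maximizer_small (R : realType) (n : nat) (eta : R) : 0 < eta <= 1 ->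
  exists2 eps : R, 0 < eps &
    forall (theta : R) alpha B, 0 <= theta < 1 -> cubic_gauge theta alpha ->
      admissible alpha B ->
      (forall C, admissible alpha C -> objective eps C <= objective eps B) ->
      forall (i j : 'I_n.+1), i != ord_max -> `|B i j| <= eta.
Proof.
move=> /andP[eta0 eta1].
pose m : R := n.+1%:R.
have m0 : 0 < m by rewrite ltr0n.
have m1 : 1 <= m by rewrite ler1n.
have mV0 : 0 < m^-1 by rewrite invr_gt0.
have [c c0 cE] := cube_root mV0.
have mc : m * c ^+ 3 = 1 by rewrite cE divff// gt_eqF.
have c1 : c <= 1.
  by rewrite -(@ler_pXn2r _ 3) ?nnegrE ?(ltW c0)// cE expr1n invf_le1.
(* [4 t / (3 c)] bounds [sum b^2] at the end, and is at most [eta^2]. *)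
pose t := c * eta ^+ 2 / 2.
have eta21 : eta ^+ 2 <= 1 by rewrite exprn_ile1// ltW.
have t0 : 0 < t by rewrite divr_gt0// mulr_gt0// exprn_gt0.
have tc : t <= c / 2 by rewrite /t ler_pM2r ?invr_gt0// ler_piMr// ltW.
(* The perturbation of the objective is then at most [eps * m = t^3 / 3]. *)
exists (t ^+ 3 / (3 * m)); first by rewrite divr_gt0 ?exprn_gt0// mulr_gt0.
set eps := (X in objective X).
move=> theta alpha B /andP[th0 th1] cub aB maxB i j im.
have [_ _ a0 a1] := cub.
have eps0 : 0 <= eps by rewrite ltW// /eps divr_gt0 ?exprn_gt0// mulr_gt0.
have epsm : eps * m = t ^+ 3 / 3 by rewrite /eps; field; rewrite gt_eqF.
have t3 : 0 < t ^+ 3 by rewrite exprn_gt0.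
pose a k := B ord_max k.
have sum_cst (x : R) : \sum_(k < n.+1) x = m * x.
  by rewrite sumr_const card_ord -[LHS]mulr_natl.
have sa : m * c - t ^+ 3 / 3 <= \sum_k a k.
  pose B0 : 'M[R]_n.+1 := \matrix_(k, l) (if k == ord_max then c else 0).
  have /maxB : admissible alpha B0.
    move=> z; have -> : z *m B0 = (z 0 ord_max * c) *: const_mx 1.
      apply/rowP => l; rewrite !mxE mulr1 (bigD1 ord_max)//= big1 => [|k km].
        by rewrite mxE eqxx addr0.
      by rewrite mxE (negbTE km) mulr0.
    rewrite cubesZ /cubes.
    under [X in _ * X]eq_bigr do rewrite mxE normr1 expr1n.
    rewrite sum_cst mulr1 normrM exprMn (gtr0_norm c0) cE mulfVK ?gt_eqF//.
    have zm := le_coord_cubes z ord_max.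
    have := a1 z; rewrite -/(cubes z) => h.
    have : theta * (cubes z - `|z 0 ord_max| ^+ 3) <= cubes z - `|z 0 ord_max| ^+ 3.
      by rewrite ler_piMl ?subr_ge0// ltW.
    lra.
  have -> : objective eps B0 = m * c.
    rewrite /objective [X in _ + eps * X]big1 => [|k km].
      by rewrite mulr0 addr0; under eq_bigr do rewrite mxE eqxx; exact: sum_cst.
    by rewrite mxE (negbTE km).
  rewrite /objective -/(a _) => h.
  have : eps * (\sum_(k | k != ord_max) B k k) <= t ^+ 3 / 3.
    rewrite -epsm ler_wpM2l//.
    apply: (@le_trans _ _ (\sum_(k < n.+1 | k != ord_max) 1)).
      apply: ler_sum => k _; apply: le_trans (ler_norm _) _.
      exact: admissible_le1 aB.
    by rewrite -(mulr1 m) -sum_cst [leRHS](bigID (fun k => k != ord_max))/= lerDl sumr_ge0.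
  lra.
have fB : 'e_ord_max *m B = row ord_max B by rewrite -rowE.
have sa3 : \sum_k `|a k| ^+ 3 <= 1.
  have := aB 'e_ord_max; rewrite cubes_delta fB /cubes.
  under eq_bigr do rewrite mxE.
  by apply: le_trans; rewrite lerDr.
have ca k : c / 2 <= a k.
  apply: (@cube_tangent_close _ c t); rewrite ?tc ?(ltW t0)//.
  apply: (@le_trans _ _ (\sum_k (`|a k| ^+ 3 - 3 * c ^+ 2 * a k + 2 * c ^+ 3))).
    rewrite [leRHS](bigD1 k)//= lerDl sumr_ge0// => l _.
    exact/cube_tangent_ge0/ltW.
  rewrite !big_split/= sumrN -mulr_sumr sum_cst.
  have h : 3 * c ^+ 2 * (m * c - t ^+ 3 / 3) <= 3 * c ^+ 2 * \sum_k a k.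
    by rewrite ler_wpM2l// mulr_ge0// sqr_ge0.
  have h2 : 3 * c ^+ 2 * (m * c - t ^+ 3 / 3) = 3 * (m * c ^+ 3) - c ^+ 2 * t ^+ 3 by field.
  have h3 : c ^+ 2 * t ^+ 3 <= t ^+ 3 by rewrite ler_piMl ?(ltW t3)// exprn_ile1// ltW.
  rewrite mulrCA; lra.
have a_ge0 k : 0 <= a k by apply: le_trans (ca k); rewrite divr_ge0 ?ltW.
pose b k := B i k.
have dir s : `|s| = 1 -> \sum_k `|a k + s * t * b k| ^+ 3 <= 1 + t ^+ 3.
  move=> s1; have := aB ('e_ord_max + (s * t) *: 'e_i).
  rewrite mulmxDl fB -scalemxAl -rowE /cubes.
  under [X in _ + X <= _]eq_bigr do rewrite !mxE -/(a _) -/(b _).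
  move=> h; apply: le_trans (le_trans h _); first by rewrite lerDr.
  rewrite (bigD1 ord_max)//= (bigD1 i)//= big1 => [|k /andP[km ki]].
    rewrite !mxE !eqxx/= (negbTE im) eq_sym (negbTE im)/= mulr0 addr0 add0r mulr1.
    by rewrite normr1 expr1n addr0 normrM s1 mul1r gtr0_norm.
  by rewrite !mxE (negbTE km) (negbTE ki)/= mulr0 addr0 normr0 expr0n.
have : \sum_k (6 * c ^+ 2 * a k - 4 * c ^+ 3 + 3 * c * t ^+ 2 * b k ^+ 2)
    <= 2 + 2 * t ^+ 3.
  have -> : 2 + 2 * t ^+ 3 = (1 + t ^+ 3) + (1 + t ^+ 3) by ring.
  apply: le_trans (lerD (dir 1 (normr1 _)) (dir (-1) _)); last by rewrite normrN1.
  rewrite -big_split/=; apply: ler_sum => k _.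
  rewrite mul1r mulN1r mulNr.
  apply: le_trans (cube_second_order _ (a_ge0 k)).
  have := cube_tangent_ge0 (a k) (ltW c0); rewrite ger0_norm//.
  have : 0 <= (a k - c / 2) * (t * b k) ^+ 2 by rewrite mulr_ge0 ?sqr_ge0 ?subr_ge0.
  rewrite exprMn; lra.
rewrite !big_split/= sumrN -!mulr_sumr sum_cst => h.
have h1 : 6 * c ^+ 2 * (m * c - t ^+ 3 / 3) <= 6 * c ^+ 2 * \sum_k a k.
  by rewrite ler_wpM2l// mulr_ge0// sqr_ge0.
have h2 : 6 * c ^+ 2 * (m * c - t ^+ 3 / 3) = 6 * (m * c ^+ 3) - 2 * (c ^+ 2 * t ^+ 3) by field.
have h3 : c ^+ 2 * t ^+ 3 <= t ^+ 3 by rewrite ler_piMl ?(ltW t3)// exprn_ile1// ltW.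
have h4 : 3 * c * t ^+ 2 * (\sum_k b k ^+ 2) <= 4 * t ^+ 3.
  have : m * (4 * c ^+ 3) = 4 * (m * c ^+ 3) by ring.
  lra.
have {}h4 : \sum_k b k ^+ 2 <= eta ^+ 2.
  have e20 : 0 <= eta ^+ 2 by rewrite sqr_ge0.
  have p0 : 0 < 3 * c * t ^+ 2 by rewrite !mulr_gt0.
  rewrite -(ler_pM2l p0); apply: (le_trans h4).
  have -> : 3 * c * t ^+ 2 * eta ^+ 2 = 6 * t ^+ 3.
    have -> : eta ^+ 2 = 2 * t / c by rewrite /t; field; rewrite gt_eqF.
    by field; rewrite gt_eqF.
  lra.
rewrite -(@ler_pXn2r _ 2) ?nnegrE ?(ltW eta0)// real_normK ?num_real//.
by apply: le_trans h4; rewrite (bigD1 j)//= lerDl sumr_ge0// => k _; rewrite sqr_ge0.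
Qed.

(** * Spanning dilations in finite dimension *)

(** As long as the rank of a matrix with rows in [A] is not full, its cokernel
    provides a linear form vanishing on its rows, hence a further row. *)
Lemma linear_span_hyperplane (R : realType) (m : nat) (A : set 'rV[R]_m) :
  (forall phi : 'cV[R]_m, phi != 0 -> exists z, A z /\ z *m phi != 0) ->
  forall w, linear_span A w.
Proof.
move=> hA w.
have [p [M [MA]]] : exists p (M : 'M[R]_(p, m)),
    (forall i, A (row i M)) /\ (m <= \rank M)%N.
  suff: forall k, (k <= m)%N -> exists p (M : 'M[R]_(p, m)),
      (forall i, A (row i M)) /\ (k <= \rank M)%N by exact.
  elim=> [|k IH] km.
    by exists 0%N, 0; split=> // -[].
  have [p [M [MA kM]]] := IH (ltnW km).
  have [kM'|Mk] := ltnP k (\rank M); first by exists p, M.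
  have /matrix0Pn[i [j Cij]] : cokermx M != 0.
    rewrite -mxrank_eq0 mxrank_coker subn_eq0 -ltnNge.
    exact: leq_ltn_trans km.
  have [|z [Az zphi]] := hA (col j (cokermx M)).
    by apply/matrix0Pn; exists i, 0; rewrite mxE.
  exists (1 + p)%N, (col_mx z M); split.
    move=> l; case: (split_ordP l) => l' ->.
      by rewrite rowKu ord1; move: Az; congr A; apply/rowP => q; rewrite mxE.
    by rewrite rowKd.
  apply: leq_ltn_trans kM _; apply: rank_ltmx.
  rewrite ltmxE; apply/andP; split; first by rewrite -addsmxE addsmxSr.
  rewrite col_mx_sub negb_and; apply/orP; left.
  apply: contra zphi => /submxP[D ->].
  by rewrite colE mulmxA -(mulmxA D) mulmx_coker mulmx0 mul0mx.
rewrite col_leq_rank => fullM; have /submxP[u ->] := submx_full w fullM.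
by exists p, (u 0), (fun i => row i M); split=> //; rewrite mulmx_sum_row.
Qed.

Lemma spanning_dilation (R : realType) (n : nat) (eta : R) (theta : R)
    (alpha : 'rV[R]_n.+1 -> R) :
  0 < eta <= 1 -> 0 <= theta < 1 -> cubic_gauge theta alpha ->
  exists B : 'M[R]_n.+1, [/\ admissible alpha B,
    forall i j, i != ord_max -> `|B i j| <= eta &
    forall w, linear_span
      [set z | z != 0 /\ alpha z + cubes (z *m B) = cubes z] w].
Proof.
move=> etaP thP cub; have [ca ha a0 _] := cub.
have [eps eps0 small] := maximizer_small n etaP.
have ale z : alpha z <= cubes z.
  have /andP[t0 t1] := thP.
  by rewrite (le_trans (cubic_gauge_le z t0 cub))// ler_piMl ?cubes_ge0// ltW.
have [B aB maxB] := objective_max eps a0 ale.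
exists B; split=> //; first exact: small thP cub aB maxB.
apply: linear_span_hyperplane => phi phi0.
have [z [zB zphi]] := norming_not_in_hyperplane eps0 thP cub aB maxB phi0.
by exists z; split=> //; split=> //; apply: contraNneq zphi => ->; rewrite mul0mx.
Qed.

(** * The space l_3 in terms of partial sums of cubes *)

Lemma cube_le (R : realType) (a b : R) : 0 <= a -> 0 <= b ->
  a ^+ 3 <= b ^+ 3 -> a <= b.
Proof. by move=> a0 b0; rewrite ler_pXn2r// nnegrE. Qed.

Lemma partial_cubes_mono (R : realType) (u : nat -> R) (N M : nat) :
  (N <= M)%N -> \sum_(k < N) `|u k| ^+ 3 <= \sum_(k < M) `|u k| ^+ 3.
Proof.
move=> NM; rewrite (big_ord_widen _ (fun k => `|u k| ^+ 3) NM) big_mkcond/=.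
by apply: ler_sum => k _; case: ifP => // _; rewrite exprn_ge0.
Qed.

Lemma nneseries_partial_le (R : realType) (u : nat -> R) (M : R) :
  (forall k, 0 <= u k) -> (forall N, \sum_(k < N) u k <= M) ->
  (\sum_(k <oo) (u k)%:E <= M%:E)%E.
Proof.
move=> u0 uM; apply: lime_le; first by apply: is_cvg_nneseries => k _ _; rewrite lee_fin.
by apply: nearW => N; rewrite big_mkord sumEFin lee_fin.
Qed.

Lemma ell_cubeE (R : realType) (x : ell (lee13 R)) :
  (`|x| ^+ 3)%:E = (\sum_(k <oo) (`|x k| ^+ 3)%:E)%E.
Proof.
have -> : (\sum_(k <oo) (`|x k| ^+ 3)%:E = \sum_(k <oo) (`|x k| `^ 3)%:E)%E.
  by apply: eq_eseriesr => k _; rewrite powR_mulrn.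
rewrite -powR_mulrn// -poweR_EFin ell_normE -poweRrM mulVf ?pnatr_eq0// poweRe1//.
by apply: nneseries_ge0 => k _ _; rewrite lee_fin powR_ge0.
Qed.

Lemma ell_partial_le (R : realType) (x : ell (lee13 R)) N :
  \sum_(k < N) `|x k| ^+ 3 <= `|x| ^+ 3.
Proof.
rewrite -lee_fin ell_cubeE -sumEFin -(big_mkord xpredT (fun k => (`|x k| ^+ 3)%:E)).
by apply: nneseries_lim_ge => k _ _; rewrite lee_fin exprn_ge0.
Qed.

Lemma ell_cube_le (R : realType) (x : ell (lee13 R)) (M : R) :
  (forall N, \sum_(k < N) `|x k| ^+ 3 <= M) -> `|x| ^+ 3 <= M.
Proof.
by move=> xM; rewrite -lee_fin ell_cubeE; exact: nneseries_partial_le.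
Qed.

Lemma ell_coord_le (R : realType) (x : ell (lee13 R)) k : `|x k| <= `|x|.
Proof.
apply: cube_le => //; apply: le_trans (ell_partial_le x k.+1).
by rewrite big_ord_recr/= lerDr sumr_ge0// => i _; rewrite exprn_ge0.
Qed.

Lemma ell_of_seq (R : realType) (u : nat -> R) (M : R) :
  (forall N, \sum_(k < N) `|u k| ^+ 3 <= M) ->
  exists x : ell (lee13 R), forall k, x k = u k.
Proof.
move=> uM.
have uL : u \in @Lfun _ nat R (@counting nat R) 3%:E.
  apply/andP; split; rewrite inE; first by [].
  rewrite /= /finite_norm Lnorm_counting// poweR_lty//.
  apply: le_lt_trans (_ : _ <= M%:E)%E (ltry _).
  rewrite (_ : (\sum_(k <oo) _)%E = (\sum_(k <oo) (`|u k| ^+ 3)%:E)%E).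
    exact: nneseries_partial_le.
  by apply: eq_eseriesr => k _ /=; rewrite powR_mulrn.
by exists (Lfun_Sub (lee13 R) uL).
Qed.

Lemma ellP (R : realType) (x y : ell (lee13 R)) : (forall k, x k = y k) -> x = y.
Proof. by move=> xy; apply/LfuneqP. Qed.

Lemma boundedOp_of_seq (R : realType) (s : ell (lee13 R) -> nat -> R) :
  (forall a x y k, s (a *: x + y) k = a * s x k + s y k) ->
  (forall x N, \sum_(k < N) `|s x k| ^+ 3 <= `|x| ^+ 3) ->
  exists S : boundedOp (ell (lee13 R)) (ell (lee13 R)),
    (forall x k, S x k = s x k) /\ (forall x, `|S x| <= `|x|).
Proof.
move=> slin sle.
have [f fE] := choice (fun x => ell_of_seq (sle x)).
have flin : linear f.
  by move=> a x y; apply: ellP => k; rewrite fE slin -!fE.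
pose F : {linear ell (lee13 R) -> ell (lee13 R)} :=
  HB.pack f (GRing.isLinear.Build _ _ _ _ f flin).
have Fle x : `|F x| <= `|x|.
  apply: cube_le => //.
  apply: ell_cube_le => N; under eq_bigr do rewrite fE; exact: sle.
have bF : bounded_near F (nbhs (0 : ell (lee13 R))).
  by apply/bounded_funP => r; exists r => x; exact: le_trans.
by exists (BoundedOp bF).
Qed.

Lemma ell_unit_exists (R : realType) (i : nat) :
  exists x : ell (lee13 R), forall k, x k = (k == i)%:R.
Proof.
apply: (@ell_of_seq _ _ 1) => N; have [iN|Ni] := ltnP i N.
  rewrite (bigD1 (Ordinal iN))//= eqxx normr1 expr1n big1 ?addr0// => k ki.
  by rewrite (_ : (k == i :> nat) = false) ?normr0 ?expr0n//; apply/negbTE.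
rewrite big1 ?ler01// => k _.
by rewrite ltn_eqF ?normr0 ?expr0n// (leq_trans (ltn_ord k)).
Qed.

Definition ell_unit (R : realType) (i : nat) : ell (lee13 R) :=
  sval (cid (ell_unit_exists R i)).

Lemma ell_unitE (R : realType) i k : ell_unit R i k = (k == i)%:R.
Proof. exact: (svalP (cid (ell_unit_exists R i))). Qed.

Definition ell_head (R : realType) (n : nat) (u : nat -> R) : ell (lee13 R) :=
  \sum_(i < n) u i *: ell_unit R i.

Lemma ell_coord_sum (R : realType) (n : nat) (f : 'I_n -> ell (lee13 R)) k :
  ell_coord (\sum_i f i) k = \sum_i f i k.
Proof. by elim/big_rec2: _ => // i y1 y2 _ <-. Qed.

Lemma ell_coordZ (R : realType) (a : R) (x : ell (lee13 R)) k :
  ell_coord (a *: x) k = a * x k.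
Proof. by []. Qed.

Lemma ell_headE (R : realType) n (u : nat -> R) k :
  ell_head n u k = if (k < n)%N then u k else 0.
Proof.
rewrite /ell_head ell_coord_sum.
under eq_bigr => i _ do rewrite ell_coordZ ell_unitE.
case: ifPn => kn.
  rewrite (bigD1 (Ordinal kn))//= eqxx mulr1 big1 ?addr0// => i ik.
  by rewrite (_ : (k == i) = false) ?mulr0// eq_sym; apply/negbTE.
rewrite big1// => i _; rewrite gtn_eqF ?mulr0//.
by rewrite (leq_trans (ltn_ord i))// leqNgt.
Qed.

Lemma ell_head_partial (R : realType) n (u : nat -> R) N : (n <= N)%N ->
  \sum_(k < N) `|ell_head n u k| ^+ 3 = \sum_(k < n) `|u k| ^+ 3.
Proof.
move=> nN; rewrite (big_ord_widen _ (fun k => `|u k| ^+ 3) nN) [RHS]big_mkcond/=.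
apply: eq_bigr => k _; rewrite ell_headE; case: ifP => //.
by rewrite normr0 expr0n.
Qed.

Lemma norm_ell_head (R : realType) n (u : nat -> R) :
  `|ell_head n u| ^+ 3 = \sum_(k < n) `|u k| ^+ 3.
Proof.
apply/eqP; rewrite eq_le -{2}(ell_head_partial u (leqnn n)) ell_partial_le andbT.
apply: ell_cube_le => N; rewrite -(ell_head_partial u (leq_maxr N n)).
by apply: partial_cubes_mono; exact: leq_maxl.
Qed.

Lemma norm_ell_unit (R : realType) i : `|ell_unit R i| = 1.
Proof.
have -> : ell_unit R i = ell_head i.+1 (ell_unit R i).
  by apply: ellP => k; rewrite ell_headE ell_unitE ltnS; case: ltngtP.
apply/eqP; rewrite -(@eqrXn2 _ 3)// norm_ell_head expr1n; apply/eqP.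
rewrite big_ord_recr/= ell_unitE eqxx normr1 expr1n big1 ?add0r// => k _.
by rewrite ell_unitE ltn_eqF ?normr0 ?expr0n.
Qed.

Lemma norm_ell_head_le (R : realType) n (x : ell (lee13 R)) : `|ell_head n x| <= `|x|.
Proof. by apply: cube_le => //; rewrite norm_ell_head ell_partial_le. Qed.

(** * Density of the finitely supported sequences *)

Lemma ell_head_cvg (R : realType) (x : ell (lee13 R)) (e : R) : 0 < e ->
  exists N, forall n, (N <= n)%N -> `|x - ell_head n x| < e.
Proof.
move=> e0; have e20 : 0 < e / 2 by rewrite divr_gt0.
have [N xN] : exists N, `|x| ^+ 3 - (e / 2) ^+ 3 < \sum_(k < N) `|x k| ^+ 3.
  apply: contrapT => noN.
  have : `|x| ^+ 3 <= `|x| ^+ 3 - (e / 2) ^+ 3.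
    by apply: ell_cube_le => N; rewrite leNgt; apply/negP => h; apply: noN; exists N.
  by rewrite lerBrDr gerDl leNgt => /negP; apply; rewrite exprn_gt0.
exists N => n Nn.
have [y yE] : exists y : ell (lee13 R), y = x - ell_head n x.
  by exists (x - ell_head n x).
rewrite -yE; apply: (@le_lt_trans _ _ (e / 2)); last first.
  by rewrite ltr_pdivrMr// ltr_pMr// ltr1n.
apply: cube_le => //; first exact: ltW.
apply: ell_cube_le => L.
apply: (@le_trans _ _ (\sum_(k < n + L) `|x k| ^+ 3 - \sum_(k < n) `|x k| ^+ 3)).
  rewrite big_split_ord/= addrAC subrr add0r.
  apply: (@le_trans _ _ (\sum_(k < n + L) `|y k| ^+ 3)).
    by apply: partial_cubes_mono; exact: leq_addl.
  have xE k : y k = if (k < n)%N then 0 else x k.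
    have -> : y k = x k - ell_head n x k by rewrite yE.
    rewrite ell_headE.
    by case: ifP; rewrite ?subrr ?subr0.
  rewrite big_split_ord/= big1 ?add0r => [|k _].
    by apply: ler_sum => k _; rewrite xE ltnNge leq_addr.
  by rewrite xE ltn_ord normr0 expr0n.
rewrite lerBlDr; apply: (le_trans (ell_partial_le x _)).
rewrite -lerBlDl; apply: le_trans (ltW xN) _.
exact: partial_cubes_mono.
Qed.

(** * Linear spans *)

Section span.
Context (R : realType) (V : lmodType R) (A : set V).

Lemma linear_span_base x : A x -> linear_span A x.
Proof.
by move=> Ax; exists 1%N, (fun=> 1), (fun=> x); split=> //; rewrite big_ord1 scale1r.
Qed.

Lemma linear_spanZ a x : linear_span A x -> linear_span A (a *: x).
Proof.
move=> [n [c [z [Az ->]]]]; exists n, (fun i => a * c i), z; split=> //.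
by rewrite scaler_sumr; apply: eq_bigr => i _; rewrite scalerA.
Qed.

Lemma linear_spanD x y : linear_span A x -> linear_span A y -> linear_span A (x + y).
Proof.
move=> [n [c [z [Az ->]]]] [n' [c' [z' [Az' ->]]]].
exists (n + n')%N, (fun i => match fintype.split i with inl j => c j | inr j => c' j end),
  (fun i => match fintype.split i with inl j => z j | inr j => z' j end).
split=> [i|]; first by case: fintype.split.
rewrite big_split_ord; congr (_ + _); apply: eq_bigr => i _.
  by rewrite (unsplitK (inl _ i)).
by rewrite (unsplitK (inr _ i)).
Qed.

Lemma linear_span0 : linear_span A 0.
Proof. by exists 0%N, (fun=> 0), (fun=> 0); split=> [[]//|]; rewrite big_ord0. Qed.

Lemma linear_span_sum n (c : 'I_n -> R) (z : 'I_n -> V) :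
  (forall i, linear_span A (z i)) -> linear_span A (\sum_i c i *: z i).
Proof.
move=> Az; elim/big_ind: _ => [|x y|i _]; [exact: linear_span0|exact: linear_spanD|].
exact: linear_spanZ.
Qed.

End span.

Lemma closed_span_units (R : realType) (A : set (ell (lee13 R))) :
  (forall i, linear_span A (ell_unit R i)) ->
  closed_span A = [set: ell (lee13 R)].
Proof.
move=> uA; apply/seteqP; split=> // x _ B /nbhs_ballP[e /= e0 xB].
have [N xN] := ell_head_cvg x e0; exists (ell_head N x); split.
  by apply: linear_span_sum.
by apply: xB; rewrite -ball_normE/=; exact: xN.
Qed.

(** * Extending a compression by a spanning dilation *)

(** Beyond index [n] the values are junk, cut off by [ell_head]. *)
Definition rowseq (R : realType) (n : nat) (z : 'rV[R]_n.+1) : nat -> R :=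
  fun i => z 0 (inord i).

Definition seqrow (R : realType) (n : nat) (u : nat -> R) : 'rV[R]_n.+1 :=
  \row_(i < n.+1) u i.

(** The first [n] coordinates of this sequence are those of [c P T P u], with
    [P] the projection [ell_head n] on the first [n] coordinates. *)
Definition compression (R : realType) (T : boundedOp (ell (lee13 R)) (ell (lee13 R)))
    (c : R) (n : nat) (u : nat -> R) (k : nat) : R :=
  c * T (ell_head n u) k.

Definition compression_cubes (R : realType)
    (T : boundedOp (ell (lee13 R)) (ell (lee13 R)))
    (c : R) (n : nat) (z : 'rV[R]_n.+1) : R :=
  \sum_(k < n) `|compression T c n (rowseq z) k| ^+ 3.

Lemma eq_ell_head (R : realType) n (u v : nat -> R) :
  (forall i, (i < n)%N -> u i = v i) -> ell_head n u = ell_head n v.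
Proof. by move=> uv; apply: eq_bigr => i _; rewrite uv. Qed.

Lemma rowseqK (R : realType) n (u : nat -> R) i : (i < n.+1)%N ->
  rowseq (seqrow n u) i = u i.
Proof. by move=> i_n; rewrite /rowseq mxE inordK. Qed.

Lemma seqrowK (R : realType) n (z : 'rV[R]_n.+1) : seqrow n (rowseq z) = z.
Proof. by apply/rowP => i; rewrite mxE /rowseq inord_val. Qed.

Lemma cubes_seqrow (R : realType) n (u : nat -> R) :
  cubes (seqrow n u) = \sum_(i < n.+1) `|u i| ^+ 3.
Proof. by apply: eq_bigr => i _; rewrite mxE. Qed.

Lemma compressionE (R : realType) (T : boundedOp (ell (lee13 R)) (ell (lee13 R)))
    (c : R) (n : nat) (u : nat -> R) (k : nat) :
  compression T c n u k = \sum_(i < n) c * T (ell_unit R i) k * u i.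
Proof.
pose y i : ell (lee13 R) := T (ell_unit R i).
have Ty : T (ell_head n u) = \sum_(i < n) u i *: y i.
  by rewrite /ell_head linear_sum; apply: eq_bigr => i _; exact: linearZ_LR.
have -> : compression T c n u k = c * \sum_(i < n) ell_coord (u i *: y i) k.
  by rewrite /compression Ty; congr (_ * _); exact: ell_coord_sum.
rewrite mulr_sumr; by apply: eq_bigr => i _; rewrite ell_coordZ mulrCA mulrC.
Qed.

Lemma compression_lin (R : realType) (T : boundedOp (ell (lee13 R)) (ell (lee13 R)))
    (c : R) (n : nat) a (u v : nat -> R) (k : nat) :
  compression T c n (fun i => a * u i + v i) k =
  a * compression T c n u k + compression T c n v k.
Proof.
rewrite !compressionE mulr_sumr -big_split/=; apply: eq_bigr => i _.
ring.
Qed.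

Lemma compression_partial_le (R : realType)
    (T : boundedOp (ell (lee13 R)) (ell (lee13 R))) (c : R) (n : nat)
    (u : nat -> R) N :
  opnorm T <= 1 -> 0 <= c ->
  \sum_(k < N) `|compression T c n u k| ^+ 3 <= c ^+ 3 * \sum_(i < n) `|u i| ^+ 3.
Proof.
move=> T1 c0.
have -> : \sum_(k < N) `|compression T c n u k| ^+ 3
    = \sum_(k < N) `|(c *: T (ell_head n u) : ell (lee13 R)) k| ^+ 3.
  by [].
apply: le_trans (ell_partial_le _ _) _.
rewrite normrZ exprMn ger0_norm// ler_wpM2l ?exprn_ge0// -norm_ell_head.
rewrite lerXn2r ?nnegrE//; apply: le_trans (le_opnormM _ _) _.
by rewrite ler_piMl.
Qed.

(** [c P T P] does not see the last of the [n.+1] coordinates and has norm at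
    most [c]. *)
Lemma compression_cubes_gauge (R : realType)
    (T : boundedOp (ell (lee13 R)) (ell (lee13 R))) (c : R) (n : nat) :
  opnorm T <= 1 -> 0 <= c -> cubic_gauge (c ^+ 3) (compression_cubes T c (n := n)).
Proof.
move=> T1 c0; split.
- apply: continuous_sum => k; apply: continuous_cube.
  have -> : (fun z : 'rV[R]_n.+1 => compression T c n (rowseq z) k)
      = (fun z => \sum_(i < n) c * T (ell_unit R i) k * z 0 (inord i)).
    by apply/funext => z; rewrite compressionE.
  by apply: continuous_sum => i; apply: continuous_scale; exact: coord_continuous.
- move=> a z; rewrite /compression_cubes mulr_sumr; apply: eq_bigr => k _.
  rewrite -exprMn -normrM; congr (`|_| ^+ 3); rewrite !compressionE mulr_sumr.
  by apply: eq_bigr => i _; rewrite /rowseq mxE mulrCA.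
- by move=> z; apply: sumr_ge0 => k _; rewrite exprn_ge0.
- move=> z; apply: le_trans (compression_partial_le n _ _ T1 c0) _.
  have -> : z 0 ord_max = rowseq z n.
    by rewrite /rowseq; congr (z _ _); apply: val_inj; rewrite /= inordK.
  by rewrite -[in cubes z](seqrowK z) cubes_seqrow big_ord_recr/= addrK.
Qed.

(** The values of [c P T P], of [B] and of the shift by [n] on the remaining
    coordinates occupy three blocks which do not overlap, so that the cubes of
    their norms add up. *)
Definition dilation (R : realType) (T : boundedOp (ell (lee13 R)) (ell (lee13 R)))
    (c : R) (n : nat) (B : 'M[R]_n.+1) (x : ell (lee13 R)) (k : nat) : R :=
  if (k < n)%N then compression T c n x k
  else if (k < n + n.+1)%N then (seqrow n x *m B) 0 (inord (k - n))
  else x (k - n)%N.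

Lemma compression_cubes_seqrow (R : realType)
    (T : boundedOp (ell (lee13 R)) (ell (lee13 R))) (c : R) (n : nat)
    (u : nat -> R) :
  compression_cubes T c (seqrow n u) = \sum_(k < n) `|compression T c n u k| ^+ 3.
Proof.
apply: eq_bigr => k _; rewrite /compression (@eq_ell_head _ n _ u)// => i i_n.
by rewrite rowseqK// ltnW.
Qed.

Lemma dilation_partial (R : realType)
    (T : boundedOp (ell (lee13 R)) (ell (lee13 R))) (c : R) (n : nat)
    (B : 'M[R]_n.+1) (x : ell (lee13 R)) L :
  \sum_(k < n + (n.+1 + L)) `|dilation T c B x k| ^+ 3 =
  compression_cubes T c (seqrow n x) + cubes (seqrow n x *m B)
    + \sum_(k < L) `|x (n.+1 + k)%N| ^+ 3.
Proof.
rewrite !big_split_ord/= addrA compression_cubes_seqrow; congr (_ + _ + _).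
- by apply: eq_bigr => k _; rewrite /dilation/= ltn_ord.
- apply: eq_bigr => k _; rewrite /dilation/= ltnNge leq_addr/= ltn_add2l ltn_ord.
  by rewrite addKn inord_val.
- apply: eq_bigr => k _; rewrite /dilation/= ltnNge leq_addr/= ltn_add2l.
  by rewrite ltnNge leq_addr/= addKn.
Qed.

Lemma dilation_exists (R : realType)
    (T : boundedOp (ell (lee13 R)) (ell (lee13 R))) (c : R) (n : nat)
    (B : 'M[R]_n.+1) :
  admissible (compression_cubes T c (n := n)) B ->
  exists S : boundedOp (ell (lee13 R)) (ell (lee13 R)),
    (forall x k, S x k = dilation T c B x k) /\ (forall x, `|S x| <= `|x|).
Proof.
move=> aB; apply: boundedOp_of_seq.
  move=> a x y k; rewrite /dilation; case: ifP => _; first exact: compression_lin.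
  case: ifP => _ //.
  have -> : seqrow n (a *: x + y : ell (lee13 R)) = a *: seqrow n x + seqrow n y.
    by apply/rowP => i; rewrite !mxE.
  by rewrite mulmxDl -scalemxAl !mxE.
move=> x N; have NN : (N <= n + (n.+1 + N))%N by rewrite addnA leq_addl.
apply: le_trans (partial_cubes_mono (dilation T c B x) NN) _.
rewrite dilation_partial; apply: le_trans (ell_partial_le x (n.+1 + N)).
by rewrite big_split_ord/= lerD2r -cubes_seqrow.
Qed.

(** The norm is attained at the vectors of [l_3^n.+1] that are norming for the
    finite block, which span it, and at the unit vectors of the shifted tail. *)
Lemma dilation_closed_span (R : realType)
    (T S : boundedOp (ell (lee13 R)) (ell (lee13 R))) (c : R) (n : nat)
    (B : 'M[R]_n.+1) :
  (forall x k, S x k = dilation T c B x k) -> (forall x, `|S x| <= `|x|) ->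
  (forall w, linear_span [set z | z != 0 /\
    compression_cubes T c z + cubes (z *m B) = cubes z] w) ->
  opnorm S <= 1 /\ closed_span (norm_attaining S) = [set: ell (lee13 R)].
Proof.
move=> SE Sle spanB.
have S1 : opnorm S <= 1 by apply: opnorm_le => // x; rewrite mul1r.
split=> //.
have sumS (x : ell (lee13 R)) L :
    compression_cubes T c (seqrow n x) + cubes (seqrow n x *m B)
    + \sum_(k < L) `|x (n.+1 + k)%N| ^+ 3 <= `|S x| ^+ 3.
  rewrite -dilation_partial; under eq_bigr do rewrite -SE.
  exact: ell_partial_le.
have unitS i : (n < i)%N -> `|S (ell_unit R i)| = 1.
  move=> ni; apply/eqP; rewrite eq_le; apply/andP; split.
    by have := Sle (ell_unit R i); rewrite norm_ell_unit.
  apply: cube_le => //; apply: le_trans (sumS _ (i - n)%N).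
  have ii : (i - n.+1 < i - n)%N by rewrite ltn_sub2l.
  rewrite (bigD1 (Ordinal ii))//= subnKC// ell_unitE eqxx normr1 addrCA lerDl.
  rewrite !addr_ge0// ?cubes_ge0//; apply: sumr_ge0 => k _; rewrite exprn_ge0//.
have opS : opnorm S = 1.
  apply/eqP; rewrite eq_le S1/=; have := unitS _ (ltnSn n) => {1}<-.
  by apply: le_trans (le_opnormM _ _) _; rewrite norm_ell_unit mulr1.
have normS (x : ell (lee13 R)) : x != 0 -> `|S x| = `|x| -> norm_attaining S x.
  by move=> x0 Sx; split=> //; rewrite opS mul1r.
apply: closed_span_units => i.
have [ni|i_n] := ltnP n i.
  apply: linear_span_base; apply: normS; last by rewrite unitS ?norm_ell_unit.
  by rewrite -normr_gt0 norm_ell_unit.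
have [m [a [z [zB eE]]]] := spanB ('e_(inord i)).
have -> : ell_unit R i = \sum_(j < m) a j *: ell_head n.+1 (rowseq (z j)).
  apply: ellP => k.
  transitivity (\sum_(j < m) a j * (if (k < n.+1)%N then rowseq (z j) k else 0));
    last first.
    rewrite ell_coord_sum; apply: eq_bigr => j _; rewrite -ell_headE.
    exact: ell_coordZ.
  rewrite ell_unitE; have [kn|kn] := ltnP k n.+1; last first.
    rewrite big1 => [|j _]; last by rewrite mulr0.
    by rewrite gtn_eqF// (leq_ltn_trans i_n).
  have := congr1 (fun v : 'rV[R]_n.+1 => v 0 (inord k)) eE.
  rewrite mxE eqxx/= summxE => h.
  have -> : (k == i) = (inord k == inord i :> 'I_n.+1).
    by rewrite -val_eqE/= !inordK.
  by rewrite h; apply: eq_bigr => j _; rewrite mxE.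
apply: linear_span_sum => j; apply: linear_span_base; have [zj0 zj] := zB j.
have nz : `|ell_head n.+1 (rowseq (z j))| ^+ 3 = cubes (z j).
  by rewrite norm_ell_head -cubes_seqrow seqrowK.
apply: normS.
  apply/eqP => h0; have := cubes_gt0 zj0.
  by rewrite -nz h0 normr0 expr0n ltxx.
apply/eqP; rewrite eq_le Sle/=; apply: cube_le => //.
apply: le_trans (sumS _ 0%N); rewrite big_ord0 addr0 nz.
have -> : seqrow n (ell_head n.+1 (rowseq (z j))) = z j.
  rewrite -[RHS]seqrowK; apply/rowP => l; rewrite !mxE ell_headE ltn_ord//.
by rewrite zj.
Qed.

(** On sequences supported on the first [n] coordinates the dilation differs
    from [c P T P] only by the rows of [B] other than the last one. The bound on
    their entries loses a factor [n.+1] in summing over the rows and less than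
    another one in summing the cubes over the columns. *)
Lemma dilation_head_le (R : realType)
    (T S : boundedOp (ell (lee13 R)) (ell (lee13 R))) (c : R) (n : nat)
    (B : 'M[R]_n.+1) (x : ell (lee13 R)) :
  (forall x k, S x k = dilation T c B x k) ->
  (forall i j, i != ord_max -> `|B i j| <= n.+1%:R ^- 3) ->
  `|S (ell_head n x) - c *: ell_head n (T (ell_head n x))| <= `|x| / n.+1%:R.
Proof.
move=> SE Bsmall; set m : R := n.+1%:R.
have m0 : 0 < m by rewrite ltr0n.
have m1 : 1 <= m by rewrite ler1n.
pose h : ell (lee13 R) := ell_head n x.
have hn k : (n <= k)%N -> h k = 0 by move=> nk; rewrite ell_headE ltnNge nk.
have [y yE] : exists y : ell (lee13 R), y = S h - c *: ell_head n (T h).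
  by exists (S h - c *: ell_head n (T h)).
rewrite -[X in `|X|]yE.
have yk k : y k = S h k - c * ell_head n (T h) k by rewrite yE.
have hx k : `|h k| <= `|x|.
  by rewrite (le_trans (ell_coord_le _ _))// norm_ell_head_le.
have rowB j : `|(seqrow n h *m B) 0 j| <= `|x| / m ^+ 2.
  rewrite mxE (le_trans (ler_norm_sum _ _ _))//.
  apply: (@le_trans _ _ (\sum_(i < n.+1) `|x| / m ^+ 3)).
    apply: ler_sum => i _; rewrite mxE normrM.
    have [->|im] := eqVneq i ord_max.
      by rewrite hn// normr0 mul0r divr_ge0// exprn_ge0// ltW.
    by apply: ler_pM => //; exact: Bsmall.
  rewrite sumr_const card_ord -[leLHS]mulr_natl -/m.
  by rewrite le_eqVlt; apply/orP; left; apply/eqP; field; rewrite gt_eqF.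
apply: cube_le => //; first by rewrite divr_ge0// ltW.
apply: ell_cube_le => N.
have NN : (N <= n + (n.+1 + N))%N by rewrite addnA leq_addl.
apply: le_trans (partial_cubes_mono y NN) _.
rewrite !big_split_ord/= big1 ?add0r => [|k _]; last first.
  rewrite yk SE ell_headE /dilation ltn_ord /compression.
  rewrite (_ : ell_head n h = h) ?subrr ?normr0 ?expr0n//.
  by apply: eq_ell_head => i i_n; rewrite ell_headE i_n.
rewrite [X in _ + X]big1 ?addr0 => [|k _]; last first.
  rewrite yk SE ell_headE /dilation ltnNge leq_addr/= ltn_add2l ltnNge leq_addr/= addKn.
  by rewrite mulr0 subr0 hn ?normr0 ?expr0n// (leq_trans (leqnSn n))// leq_addr.
apply: (@le_trans _ _ (\sum_(k < n.+1) (`|x| / m ^+ 2) ^+ 3)).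
  apply: ler_sum => k _.
  rewrite yk SE ell_headE /dilation ltnNge leq_addr/= ltn_add2l ltn_ord addKn.
  rewrite mulr0 subr0 inord_val lerXn2r ?nnegrE//.
  by rewrite divr_ge0// exprn_ge0// ltW.
rewrite sumr_const card_ord -[leLHS]mulr_natl -/m.
have -> : m * (`|x| / m ^+ 2) ^+ 3 = (`|x| / m) ^+ 3 * (m^-1) ^+ 2.
  by field; rewrite gt_eqF.
rewrite ler_piMr//; first by rewrite exprn_ge0// divr_ge0// ltW.
by rewrite exprn_ile1// ?invr_ge0 ?(ltW m0)// invf_le1.
Qed.

(** * Density *)

(** With [h = P x], the difference [S x - T x] is the telescoping sum of
    [S (x - h)], [S h - c P T h], [c P T h - P T x] and [P T x - T x]. *)
Lemma SOT_approx (R : realType)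
    (T : boundedOp (ell (lee13 R)) (ell (lee13 R))) (n : nat) :
  opnorm T <= 1 ->
  exists S : boundedOp (ell (lee13 R)) (ell (lee13 R)),
    [/\ opnorm S <= 1, closed_span (norm_attaining S) = [set: ell (lee13 R)] &
      forall x, `|S x - T x| <=
        2 * `|x - ell_head n x| + 2 * (`|x| / n.+1%:R) + `|T x - ell_head n (T x)|].
Proof.
move=> T1; set m : R := n.+1%:R.
have m0 : 0 < m by rewrite ltr0n.
have m1 : 1 <= m by rewrite ler1n.
(* [c < 1] leaves the room needed by the spanning argument. *)
pose d : R := (m + 1)^-1.
have d0 : 0 < d by rewrite invr_gt0 addr_gt0.
have d1 : d < 1 by rewrite invf_lt1 ?addr_gt0// ltrDr.
have dm : d <= m^-1 by rewrite lef_pV2 ?posrE ?addr_gt0// lerDl.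
pose c := 1 - d.
have c0 : 0 <= c by rewrite subr_ge0 ltW.
have c1 : c < 1 by rewrite gtrBl.
have etaP : 0 < m ^- 3 <= 1.
  by rewrite invr_gt0 exprn_gt0//= invf_le1 ?exprn_gt0// exprn_ege1.
have thP : 0 <= c ^+ 3 < 1 by rewrite exprn_ge0//= exprn_ilt1.
have [B [aB Bsmall spanB]] :=
  spanning_dilation etaP thP (compression_cubes_gauge n T1 c0).
have [S [SE Sle]] := dilation_exists aB.
have [S1 Sspan] := dilation_closed_span SE Sle spanB.
have Tle x : `|T x| <= `|x|.
  by apply: le_trans (le_opnormM _ _) _; rewrite ler_piMl.
exists S; split=> // x.
pose h : ell (lee13 R) := ell_head n x.
pose K : ell (lee13 R) := ell_head n (T h).
pose K' : ell (lee13 R) := ell_head n (T x).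
set a := `|x - ell_head n x|; set q := `|x| / m; set b := `|T x - ell_head n (T x)|.
have -> : S x - T x = S (x - h) + ((S h - c *: K) + ((c *: K - K') + (K' - T x))).
  by rewrite linearB/= !subrKA.
have e1 : `|S (x - h)| <= a by exact: Sle.
have e2 : `|S h - c *: K| <= q by exact: dilation_head_le SE Bsmall.
have e3 : `|K' - T x| <= b by rewrite distrC.
have e4 : `|c *: K - K'| <= q + a.
  have -> : c *: K - K' = - (d *: K) + (K - K').
    by rewrite scalerBl scale1r addrA [- _ + K]addrC.
  apply: le_trans (ler_normD _ _) _; apply: lerD.
    rewrite normrN normrZ gtr0_norm// mulrC ler_pM// ?(ltW d0)//.
    by rewrite (le_trans (norm_ell_head_le _ _))// (le_trans (Tle _))// norm_ell_head_le.
  have -> : K - K' = ell_head n (T (h - x)).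
    rewrite linearB /K /K' /ell_head -sumrB; apply: eq_bigr => i _.
    by rewrite -scalerBl.
  apply: le_trans (norm_ell_head_le _ _) _; apply: le_trans (Tle _) _.
  by rewrite distrC.
apply: le_trans (ler_normD _ _) _.
apply: le_trans (lerD e1 (ler_normD _ _)) _.
apply: le_trans (lerD (lexx _) (lerD e2 (ler_normD _ _))) _.
apply: le_trans (lerD (lexx _) (lerD (lexx _) (lerD e4 e3))) _.
lra.
Qed.

Theorem proposition4p2 (R : realType) :
  dense [set T : set_type (op_ball1 (ell (lee13 R)) (ell (lee13 R))) |
    closed_span (norm_attaining (set_val T)) = [set: ell (lee13 R)]].
Proof.
move=> O [T0 OT0] [U oU UO].
pose T := set_val T0.
have T1 : opnorm T <= 1 by have := set_mem (svalP T0).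
have [S S_] := choice (fun n => SOT_approx n T1).
have ST : (S n) @[n --> \oo] --> T.
  apply/SOT_cvgP => x; apply/cvgr0Pnorm_lt => e e0.
  have e4 : 0 < e / 4 by rewrite divr_gt0.
  have e8 : 0 < e / 8 by rewrite divr_gt0.
  have [N1 xN] := ell_head_cvg x e8.
  have [N2 TN] := ell_head_cvg (T x) e4.
  pose N3 := (Num.trunc ((`|x| + 1) * (8 / e))).+1.
  exists (N1 + N2 + N3)%N => //= n nN.
  have [_ _ /(_ x)] := S_ n.
  have {}xN := xN n (leq_trans (leq_trans (leq_addr N2 N1) (leq_addr _ _)) nN).
  have {}TN := TN n (leq_trans (leq_trans (leq_addl N1 N2) (leq_addr _ _)) nN).
  have n0 : 0 < n.+1%:R :> R by rewrite ltr0n.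
  have : `|x| / n.+1%:R <= e / 8.
    rewrite ler_pdivrMr// mulrC -ler_pdivrMr// invf_div.
    apply: (@le_trans _ _ ((`|x| + 1) * (8 / e))).
      by rewrite ler_wpM2r ?lerDl// divr_ge0// ltW.
    apply: le_trans (ltW (truncnS_gt _)) _.
    by rewrite ler_nat (leq_trans _ (leqnSn _))// (leq_trans _ nN)// leq_addl.
  move=> xe Sn /=; rewrite normr_id; apply: le_lt_trans Sn _.
  apply: (@lt_le_trans _ _ (2 * (e / 8) + 2 * (e / 8) + e / 4)).
    apply: ler_ltD; last exact: TN.
    by apply: lerD; rewrite ler_pM2l//; exact: ltW.
  by clear UO; lra.
have UT : nbhs T U by apply: open_nbhs_nbhs; split=> //; rewrite -UO in OT0.
have [n _ /(_ n (leqnn n)) USn] := ST _ UT.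
have [S1 Sspan _] := S_ n.
exists (exist _ (S n) (mem_set S1)); split=> //.
by rewrite -UO.
Qed.
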